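(* Let $(X,\triangleright_{z_{ij}})$ be a $p$-shelf with parameter set $Y\subseteq X$, and let $R^{z_{ij}}:X\times X\to X\times X$ be the $p$-shelf solution $R^{z_{ij}}(b,a)=(b,\,b\triangleright_{z_{ij}}a)$ for all $a,b\in X$, $z_i,z_j\in Y$. For every $z\in Y$ let $K^z:X\to X$, $a\mapsto\kappa^z(a)$, be a bijective map. Then $K^z$ is a reflection if and only if, for all $a,b\in X$ and $z_i,z_j\in Y$, (i) $(b\triangleright_{z_{\bar ji}}a)\triangleright_{z_{ij}}\kappa^{z_j}(b)=\kappa^{z_j}\big((b\triangleright_{z_{\bar ji}}a)\triangleright_{z_{i\bar j}}b\big)$, (ii) $\kappa^{z_i}(a)\triangleright_{z_{ij}}b=a\triangleright_{z_{\bar ij}}b$.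
   Context: $X$ and $Y\subseteq X$ are non-empty sets; a superscript or subscript $z_{ij}$ denotes dependence on the ordered pair $(z_i,z_j)\in Y\times Y$. $\mu:Y\to Y$ is a fixed involutive map and $z_{\bar i}:=\mu(z_i)$; thus e.g. $z_{i\bar j}$ means dependence on $(z_i,\mu(z_j))$. $(X,\triangleright_{z_{ij}})$ is a (left) $p$-shelf if $a\triangleright_{z_{ik}}(b\triangleright_{z_{jk}}c)=(a\triangleright_{z_{ij}}b)\triangleright_{z_{jk}}(a\triangleright_{z_{ik}}c)$ for all $a,b,c\in X$, $z_i,z_j,z_k\in Y$. Given $R^{z_{ij}}:X\times X\to X\times X$, put $R_{12}^{z_{ij}}=R^{z_{ij}}$ and $R_{21}^{z_{ij}}=\pi R^{z_{ij}}\pi$ with $\pi(x,y)=(y,x)$. Put $K_1^z(a,b)=(\kappa^z(a),b)$ and $K_2^z(a,b)=(a,\kappa^z(b))$. The family $K^z$ $(z\in Y)$ is a (parametric) reflection (for $R$) if for all $z_1,z_2\in Y$ the following identity of maps on $X\times X$ (products denote composition) holds: $$R_{12}^{z_{12}}K_1^{z_1}R_{21}^{z_{2\bar1}}K_2^{z_2}=K_2^{z_2}R_{12}^{z_{1\bar2}}K_1^{z_1}R_{21}^{z_{\bar2\bar1}}.$$ *)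

(* Defs.v *)
(* MathComp, with classical_sets for the parameter set Y as a subset of X. *)
From mathcomp Require Import all_boot.
From mathcomp Require Import classical_sets.

Set Implicit Arguments.
Unset Strict Implicit.
Unset Printing Implicit Defensive.

(* A subset Y of X coerces to the type of its elements, so a family depending
   on an ordered pair (z_i, z_j) of Y x Y is a curried function of z_i, z_j : Y,
   the superscript z_ij becoming the two leading arguments. *)

Section ParametricShelf.
Variables (X : Type) (Y : set X).

Definition pshelf (op : Y -> Y -> X -> X -> X) : Prop :=
  forall (zi zj zk : Y) (a b c : X),
    op zi zk a (op zj zk b c) = op zj zk (op zi zj a b) (op zi zk a c).

Definition pshelf_solution (op : Y -> Y -> X -> X -> X)
    (zi zj : Y) : X * X -> X * X :=
  fun u => (u.1, op zi zj u.1 u.2).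

Definition R12 (R : Y -> Y -> X * X -> X * X) (zi zj : Y) : X * X -> X * X :=
  R zi zj.

(* The flip acts on the components only: the parameters of [R21 R zi zj] keep
   the order (zi, zj). *)
Definition R21 (R : Y -> Y -> X * X -> X * X) (zi zj : Y) : X * X -> X * X :=
  swap_pair \o R zi zj \o swap_pair.

Definition K1 (kappa : Y -> X -> X) (z : Y) : X * X -> X * X :=
  fun u => (kappa z u.1, u.2).

Definition K2 (kappa : Y -> X -> X) (z : Y) : X * X -> X * X :=
  fun u => (u.1, kappa z u.2).

Definition reflection (mu : Y -> Y) (R : Y -> Y -> X * X -> X * X)
    (kappa : Y -> X -> X) : Prop :=
  forall z1 z2 : Y,
    R12 R z1 z2 \o K1 kappa z1 \o R21 R z2 (mu z1) \o K2 kappa z2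
    =1
    K2 kappa z2 \o R12 R z1 (mu z2) \o K1 kappa z1 \o R21 R (mu z2) (mu z1).

End ParametricShelf.

(* Main.v *)
(** Evaluated at [(a, b)], the two sides of the reflection equation have first
    components [kappa z1 A] and [kappa z1 B], where [A] and [B] are the two
    sides of (ii) at [(z2, mu z1)]; injectivity of [kappa z1] makes their
    equality equivalent to (ii). Given (ii), the equality of the second
    components is (i) at [(mu z1, z2)]. As [mu] is onto, all pairs of
    parameters are reached. *)
Require Import Defs.
From mathcomp Require Import all_boot.
From mathcomp Require Import classical_sets.

Theorem proposition2p2 (X : Type) (Y : set X) (Y0 : (Y !=set0)%classic)
    (mu : Y -> Y) (muI : involutive mu)
    (op : Y -> Y -> X -> X -> X) (op_pshelf : pshelf op)
    (kappa : Y -> X -> X) (kappa_bij : forall z : Y, bijective (kappa z)) :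
  reflection mu (pshelf_solution op) kappa <->
  (forall (a b : X) (zi zj : Y),
     op zi zj (op (mu zj) zi b a) (kappa zj b) =
       kappa zj (op zi (mu zj) (op (mu zj) zi b a) b)
     /\
     op zi zj (kappa zi a) b = op (mu zi) zj a b).
Proof.
split=> [refl | conds z1 z2 [a b]].
- have ii a b zi zj : op zi zj (kappa zi a) b = op (mu zi) zj a b.
    (* With [z1 := mu zj], the parameter [mu z1] of [R21] becomes [zj] by involutivity. The input is
       [(b, a)] since the flip makes the second entry the left operand. *)
    have [+ _] := refl (mu zj) zi (b, a).
    by rewrite /= muI => /(bij_inj (kappa_bij _)).
  move=> a b zi zj; split; last exact: ii.
  have [_ +] := refl (mu zi) zj (a, b).
  (* Stripping [kappa (mu zi)] by [ii] leaves [mu (mu zi)] in the outer operations, hence the second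
     [muI]. *)
  by rewrite /= muI !ii muI.
- have ii c d zi zj : op zi zj (kappa zi c) d = op (mu zi) zj c d.
    by case: (conds c d zi zj).
  have [i _] := conds a b (mu z1) z2.
  (* Once [ii] has cleared [kappa] from all left operands, the first components coincide and only
     (i) remains. *)
  by rewrite /R12 /R21 /K1 /K2 /pshelf_solution /= !ii i.
Qed.
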